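(* If $G$ is a fixed non-bipartite graph, then $r(L_G, K_n^{(3)}) = n^{\Theta(n)}$, where the implied constants depend on $G$; i.e. there exist constants $c_G, C_G>0$ such that for all sufficiently large $n$, $n^{c_G n}\le r(L_G,K_n^{(3)})\le n^{C_G n}$.
   Context: A $3$-graph is a $3$-uniform hypergraph. For $3$-graphs $H_1,H_2$, $r(H_1,H_2)$ is the smallest $N$ such that every $3$-graph on $N$ vertices contains a copy of $H_1$ or its complement contains a copy of $H_2$. $K_n^{(3)}$ is the complete $3$-graph on $n$ vertices. For a graph $G$, its link hypergraph $L_G$ is the $3$-graph on vertex set $V(G)\cup\{u\}$ (with $u$ a new vertex) whose edges are exactly the triples $\{u,v,w\}$ with $\{v,w\}\in E(G)$. *)

(* Defs.v *)
From mathcomp Require Import all_boot.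

Set Implicit Arguments.
Unset Strict Implicit.
Unset Printing Implicit Defensive.

Record sgraph (V : finType) := SGraph {
  adj :> rel V;
  adj_sym : symmetric adj;
  adj_irr : irreflexive adj }.

(* A is one side of the bipartition: every edge joins A to its complement. *)
Definition bipartite (V : finType) (G : sgraph V) : Prop :=
  exists A : {set V}, forall x y, G x y -> (x \in A) != (y \in A).

Record graph3 (T : finType) := Graph3 {
  edges3 : {set {set T}};
  card_edges3 : forall e, e \in edges3 -> #|e| = 3 }.

Fact complete3_card (T : finType) (e : {set T}) :
  e \in [set e' : {set T} | #|e'| == 3] -> #|e| = 3.
Proof. by rewrite inE => /eqP. Qed.

Definition complete3 (n : nat) : graph3 'I_n :=
  Graph3 (@complete3_card 'I_n).

Fact compl3_card (T : finType) (H : graph3 T) (e : {set T}) :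
  e \in [set e' : {set T} | (#|e'| == 3) && (e' \notin edges3 H)] -> #|e| = 3.
Proof. by rewrite inE => /andP[/eqP]. Qed.

Definition compl3 (T : finType) (H : graph3 T) : graph3 T :=
  Graph3 (@compl3_card T H).

(* None is the new vertex u of the link hypergraph. *)
Definition link_edges (V : finType) (G : sgraph V) : {set {set option V}} :=
  [set [set None; Some p.1; Some p.2] | p : V * V & G p.1 p.2].

Fact link_card (V : finType) (G : sgraph V) (e : {set option V}) :
  e \in link_edges G -> #|e| = 3.
Proof.
case/imsetP=> -[x y]; rewrite inE /= => Gxy ->.
have neq_xy : x != y by apply: contraTneq Gxy => ->; rewrite adj_irr.
rewrite -setUA cardsU1 cards2 !inE /=.
by rewrite (inj_eq (@Some_inj _)) neq_xy.
Qed.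

Definition link (V : finType) (G : sgraph V) : graph3 (option V) :=
  Graph3 (@link_card V G).

(* Copies are subhypergraphs, not necessarily induced. *)
Definition contains_copy (U T : finType) (F : graph3 U) (H : graph3 T) : Prop :=
  exists2 f : U -> T, injective f &
    forall e, e \in edges3 F -> f @: e \in edges3 H.

Definition ramsey_prop (U1 U2 : finType) (H1 : graph3 U1) (H2 : graph3 U2)
    (N : nat) : Prop :=
  forall (T : finType) (H : graph3 T), #|T| = N ->
    contains_copy H1 H \/ contains_copy H2 (compl3 H).

(* N = r(H1, H2). *)
Definition is_ramsey_number (U1 U2 : finType) (H1 : graph3 U1) (H2 : graph3 U2)
    (N : nat) : Prop :=
  ramsey_prop H1 H2 N /\ forall M, ramsey_prop H1 H2 M -> N <= M.

Lemma is_ramsey_number_uniq (U1 U2 : finType) (H1 : graph3 U1)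
    (H2 : graph3 U2) (M N : nat) :
  is_ramsey_number H1 H2 M -> is_ramsey_number H1 H2 N -> M = N.
Proof.
move=> [pM minM] [pN minN]; apply/eqP.
by rewrite eqn_leq (minM _ pN) (minN _ pM).
Qed.

(* Main.v *)
(** Upper bound.  Grow an independent set X together with a candidate set S all
    of whose members complete no edge with two points of X.  Take v in S.
    Either every x in X has small link degree at v inside S, and v joins X, or
    some x has many link neighbours of v in S; then S shrinks to them and the
    clique number of the link of x in S drops.  As links are K_t-free, the
    second case occurs at most t times per point of X.

    Lower bound.  Let F be the graph on the cube {0,1}^d joining nearly
    antipodal points.  It has large odd girth, so a non-bipartite G has no
    homomorphism to F, while any two vertex sets larger than h = |F|^(1 - c)
    span an edge.  Label the ordered pairs of vertices by random points f(u,v)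
    of F and let {u,v,w} be an edge when at each of its three vertices the two
    labels are adjacent; then f(u,.) maps the link of u homomorphically to F.
    A set A + B + C of 3m vertices spans no such edge with probability
    |F|^(-c' m^2).  To see this, expose the vertices c of C one at a time and
    record for each (a,b) the set P(a,b) of pairs (f(a,c), f(b,c)) with f(c,a)
    adjacent to f(c,b).  If half of these sets become full, f(a,b) and f(b,a)
    have few admissible values.  Otherwise most steps enlarge the sets P(a,b)
    very little in total, and each such step has probability |F|^(-c' m). *)

Require Import Defs.
From mathcomp Require Import all_boot all_order all_algebra.
From mathcomp Require Import reals exp.
From mathcomp Require Import boolp zify ring lra.

Set Implicit Arguments.
Unset Strict Implicit.
Unset Printing Implicit Defensive.

(** * Upper bound *)

Definition independent3 (T : finType) (H : graph3 T) (X : {set T}) :=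
  forall e, e \in edges3 H -> ~~ (e \subset X).

Definition link_clique_bound (T : finType) (H : graph3 T) (x : T)
    (S : {set T}) (a : nat) :=
  forall K : {set T}, K \subset S ->
    {in K &, forall u w, u != w -> [set x; u; w] \in edges3 H} -> #|K| < a.

Lemma edge3_neq (T : finType) (H : graph3 T) (x y z : T) :
  [set x; y; z] \in edges3 H -> [/\ x != y, x != z & y != z].
Proof.
move/card_edges3; rewrite -setUA cardsU1 cards2 !inE => /eqP.
by case: (x == y); case: (x == z); case: (y == z).
Qed.

Lemma independent3_add (T : finType) (H : graph3 T) (X : {set T}) (v : T) :
  independent3 H X ->
  {in X &, forall x y, x != y -> [set x; y; v] \notin edges3 H} ->
  independent3 H (v |: X).
Proof.
move=> indX nv e He; apply/negP => sub.
case: (boolP (v \in e)) => [ve|nve]; last first.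
  move: (indX e He); apply/negP; rewrite negbK; apply/subsetP => x xe.
  move/subsetP/(_ x xe): sub; rewrite !inE => /orP[/eqP xv|//].
  by rewrite -xv xe in nve.
have: #|e :\ v| == 2 by have := card_edges3 He; rewrite (cardsD1 v) ve add1n => /eqP.
case/cards2P => x [y [nxy exy]].
have inX z : z \in [set x; y] -> z \in X.
  rewrite -exy !inE => /andP[zv ze]; move/subsetP/(_ z ze): sub.
  by rewrite !inE (negbTE zv).
have := nv x y (inX x (set21 _ _)) (inX y (set22 _ _)) nxy.
by rewrite setUC -exy setD1K // He.
Qed.

Section GreedyIndependent.
Variables (T : finType) (H : graph3 T) (n t : nat).
Hypothesis link_bound : forall x, link_clique_bound H x [set~ x] t.

(** The potential is the sum of the clique bounds [a x] plus [t.+1] for every point still missing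
    from [X]. Each round lowers it by one and keeps a fraction 1 / (2n + 2) of [S]: passing to link
    neighbours lowers one [a x], while a new point trades [t.+1] for a clique bound [t]. *)
Lemma greedy_independent (phi : nat) (X S : {set T}) (a : T -> nat) :
  {in X, forall x, x \notin S /\ link_clique_bound H x S (a x)} ->
  {in X &, forall x y, x != y -> {in S, forall w, [set x; y; w] \notin edges3 H}} ->
  independent3 H X -> #|X| <= n ->
  \sum_(x in X) a x + (n - #|X|) * t.+1 <= phi ->
  (2 * n + 2) ^ phi <= #|S| ->
  exists2 Y : {set T}, #|Y| = n & independent3 H Y.
Proof.
elim: phi X S a => [|phi IH] X S a bX nX indX leX.
  rewrite leqn0 addn_eq0 muln_eq0 orbF subn_eq0 => /andP[_ le2] _.
  by exists X => //; apply/eqP; rewrite eqn_leq leX le2.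
case: (ltnP #|X| n) => [ltX|geX]; last first.
  by exists X => //; apply/eqP; rewrite eqn_leq leX geX.
move=> le_phi le_S.
have S2 : 2 <= #|S|.
  apply: leq_trans le_S; rewrite expnS.
  have : 0 < (2 * n + 2) ^ phi by rewrite expn_gt0; lia.
  nia.
have [v vS] : exists v, v \in S by apply/card_gt0P; lia.
pose N x := [set w in S | [set x; v; w] \in edges3 H].
case: (boolP [exists x in X, #|S| <= (2 * n + 2) * #|N x|]).
  case/exists_inP => x xX leN.
  have [xS bx] := bX x xX.
  have NS : N x \subset S by apply/subsetP => w; rewrite inE => /andP[].
  have vN : v \notin N x.
    by rewrite inE vS /=; apply/negP => /edge3_neq[_ _]; rewrite eqxx.
  have ax : 0 < a x.
    have := bx set0 (sub0set _); rewrite cards0; apply.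
    by move=> u w; rewrite inE.
  apply: (IH X (N x) (fun y => if y == x then (a x).-1 else a y)) => //.
  - move=> y yX; have [yS by_] := bX y yX; split.
      by apply: contra yS => /(subsetP NS).
    case: eqP => [->|_]; last first.
      by move=> K KS; apply: by_; apply: subset_trans KS NS.
    move=> K KS cK.
    (* A clique inside the link neighbours of [v] extends by [v] itself, so the clique bound of [x]
       drops by one. *)
    have vK : v \notin K by apply: contra vN => /(subsetP KS).
    have := bx (v |: K); rewrite cardsU1 vK /= => bvK.
    rewrite ltn_predRL -add1n; apply: bvK.
      rewrite subUset sub1set vS /=; exact: subset_trans KS NS.
    move=> u w; rewrite !inE => /orP[/eqP->|uK] /orP[/eqP->|wK]; rewrite ?eqxx //.
    + by move/(subsetP KS): wK; rewrite inE => /andP[].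
    + by move/(subsetP KS): uK; rewrite inE => /andP[_]; rewrite setUAC.
    + exact: cK.
  - move=> y z yX zX nyz w wN; apply: nX => //; exact: (subsetP NS).
  - move: le_phi; rewrite !(bigD1 x xX) /= eqxx.
    rewrite [in X in _ -> X](eq_bigr a); first by move: (\sum_(_ in X | _) _); lia.
    by move=> y /andP[_ /negbTE->].
  - move: le_S; rewrite expnS; nia.
move/exists_inPn => small.
pose S' := (S :\ v) :\: \bigcup_(x in X) N x.
have S'S : S' \subset S.
  by apply/subsetP => w; rewrite !inE => /andP[_ /andP[]].
have vX : v \notin X by apply/negP => /bX[]; rewrite vS.
have cardN : (2 * n + 2) * #|\bigcup_(x in X) N x| <= n * #|S|.
  have : #|\bigcup_(x in X) N x| <= \sum_(x in X) #|N x|.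
    elim/big_rec2: _ => [|x m A _ le]; first by rewrite cards0.
    by apply: leq_trans (leq_card_setU _ _) _; rewrite leq_add2l.
  have : \sum_(x in X) (2 * n + 2) * #|N x| <= #|X| * #|S|.
    rewrite -sum_nat_const; apply: leq_sum => x xX.
    by apply: ltnW; rewrite ltnNge small.
  rewrite -big_distrr /=; nia.
(* The sets [N x] cover less than half of [S]; as [#|S|] is at least 2, deleting [v] too leaves the
   required fraction. *)
have cardS' : #|S| <= (2 * n + 2) * #|S'|.
  have e1 := cardsD1 v S; rewrite vS in e1.
  have := cardsID (\bigcup_(x in X) N x) (S :\ v); rewrite -/S'.
  have := subset_leq_card (subsetIr (S :\ v) (\bigcup_(x in X) N x)).
  nia.
apply: (IH (v |: X) S' (fun y => if y == v then t else a y)).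
- move=> y /setU1P[->|yX].
    rewrite eqxx; split; first by rewrite /S' !inE eqxx /= andbF.
    move=> K KS; apply: link_bound; apply: subset_trans KS _.
    by apply/subsetP => w; rewrite !inE => /andP[_ /andP[]].
  have [yS by_] := bX y yX; split; first by apply: contra yS => /(subsetP S'S).
  case: eqP => [yv|_]; first by rewrite -yv yX in vX.
  by move=> K KS; apply: by_; apply: subset_trans KS S'S.
- have nv x w : x \in X -> w \in S' -> [set x; v; w] \notin edges3 H.
    move=> xX; rewrite !inE => /andP[nU /andP[_ wS]].
    by apply: contra nU => e; apply/bigcupP; exists x; rewrite // inE wS.
  move=> x y /setU1P[->|xX] /setU1P[->|yX]; rewrite ?eqxx //.
  + by move=> _ w wS; rewrite [[set v; y]]setUC; apply: nv.
  + by move=> _ w wS; apply: nv.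
  + move=> nxy w /(subsetP S'S); exact: nX.
- by apply: independent3_add => // x y xX yX nxy; apply: nX.
- by rewrite cardsU1 vX; lia.
- move: le_phi; rewrite (big_setU1 _ vX) /= eqxx cardsU1 vX.
  rewrite [in X in _ -> X](eq_bigr a); last first.
    by move=> y yX; case: eqP => // yv; rewrite -yv yX in vX.
  nia.
- move: le_S; rewrite expnS; nia.
Qed.

End GreedyIndependent.

Lemma contains_complete3 (T : finType) (H : graph3 T) (n : nat) (Y : {set T}) :
  #|Y| = n -> independent3 H Y -> contains_copy (complete3 n) (compl3 H).
Proof.
move=> cY indY; exists (fun i => enum_val (cast_ord (esym cY) i)).
  by move=> i j /enum_val_inj /cast_ord_inj.
move=> e; rewrite !inE => /eqP ce.
rewrite card_imset ?ce /=; last by move=> i j /enum_val_inj /cast_ord_inj.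
apply/negP => /indY /negP; apply.
by apply/subsetP => _ /imsetP[i _ ->]; apply: enum_valP.
Qed.

Lemma contains_link (T : finType) (H : graph3 T) (V : finType) (G : sgraph V)
    (x : T) (K : {set T}) :
  K \subset [set~ x] ->
  {in K &, forall u w, u != w -> [set x; u; w] \in edges3 H} -> #|V| <= #|K| ->
  contains_copy (link G) H.
Proof.
move=> Kx cK leVK.
pose g v := enum_val (widen_ord leVK (enum_rank v)).
have g_inj : injective g.
  move=> u v /enum_val_inj /(congr1 val) /= /ord_inj; exact: enum_rank_inj.
have gK v : g v \in K by apply: enum_valP.
have gx v : g v != x by move/(subsetP Kx): (gK v); rewrite !inE.
exists (fun o => if o is Some v then g v else x).
  move=> [u|] [v|] //.
  - by move/g_inj->.
  - by move/eqP; rewrite (negbTE (gx u)).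
  - by move/esym/eqP; rewrite (negbTE (gx v)).
move=> e /imsetP[[u v]]; rewrite inE /= => Guv ->.
rewrite !imsetU !imset_set1; apply: cK => //.
by rewrite (inj_eq g_inj); apply: contraTneq Guv => ->; rewrite adj_irr.
Qed.

Lemma link_ramsey_upper (V : finType) (G : sgraph V) (n : nat) :
  ramsey_prop (link G) (complete3 n) ((2 * n + 2) ^ (n * #|V|.+1)).
Proof.
move=> T H cT.
have [[x [K [Kx cK leVK]]]|nK] := pselect (exists x (K : {set T}),
    [/\ K \subset [set~ x],
      {in K &, forall u w, u != w -> [set x; u; w] \in edges3 H} & #|V| <= #|K|]).
  by left; exact: contains_link Kx cK leVK.
right.
have bnd x : link_clique_bound H x [set~ x] #|V|.
  by move=> K Kx cK; rewrite ltnNge; apply/negP => leVK; apply: nK; exists x, K.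
have [Y cY indY] : exists2 Y : {set T}, #|Y| = n & independent3 H Y.
  apply: (@greedy_independent T H n #|V| bnd (n * #|V|.+1) set0 setT (fun=> 0)).
  - by move=> x; rewrite inE.
  - by move=> x y; rewrite inE.
  - move=> e eE; apply/negP; rewrite subset0 => /eqP e0.
    by have := card_edges3 eE; rewrite e0 cards0.
  - by rewrite cards0.
  - by rewrite big_set0 cards0 subn0.
  - by rewrite cardsT cT.
exact: contains_complete3 indY.
Qed.

(** * The nearly antipodal graph of the cube *)

(** An iterated product, so that induction on [d] splits off the first coordinate. *)
Fixpoint cube (d : nat) : finType :=
  if d is d'.+1 then ((bool * cube d')%type : finType) else (unit : finType).

Fixpoint hamming (d : nat) : cube d -> cube d -> nat :=
  if d is d'.+1 return cube d -> cube d -> nat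
  then fun x y => (x.1 != y.1) + hamming x.2 y.2 else fun _ _ => 0.

Fixpoint antipode (d : nat) : cube d -> cube d :=
  if d is d'.+1 return cube d -> cube d
  then fun x => (~~ x.1, antipode x.2) else id.

Lemma card_cube d : #|cube d| = 2 ^ d.
Proof.
elim: d => [|d IH]; first by rewrite card_unit.
by rewrite [LHS]card_prod card_bool IH expnS.
Qed.

Lemma hamming_sym d (x y : cube d) : hamming x y = hamming y x.
Proof. by elim: d x y => //= d IH x y; rewrite eq_sym IH. Qed.

Lemma hamming_refl d (x : cube d) : hamming x x = 0.
Proof. by elim: d x => //= d IH x; rewrite eqxx IH. Qed.

Lemma hamming_tri d (x y z : cube d) : hamming x z <= hamming x y + hamming y z.
Proof.
elim: d x y z => //= d IH x y z; have := IH x.2 y.2 z.2.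
by case: x y z => [[] ?] [[] ?] [[] ?] /=; lia.
Qed.

Lemma hamming_antipode d (x y : cube d) :
  hamming x (antipode y) + hamming x y = d.
Proof.
elim: d x y => //= d IH x y; have := IH x.2 y.2.
by case: x y => [[] ?] [[] ?] /=; lia.
Qed.

Lemma antipodeK d : involutive (@antipode d).
Proof. by elim: d => //= d IH [b x] /=; rewrite negbK IH. Qed.

Definition far_rel d t : rel (cube d) := fun x y => d <= hamming x y + t.

(** Crossing an edge of [G] moves the image to within [t] of its antipode. Along a walk the distance
    to the start is thus alternately near 0 and near [d], with error [t] per edge; while the error
    stays below d / 2, this distance determines a side. *)
Lemma far_rel_bipartite (V : finType) (G : sgraph V) d t (phi : V -> cube d) :
  2 * (#|V|.+1 * t) < d ->
  (forall x y, G x y -> far_rel t (phi x) (phi y)) -> bipartite G.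
Proof.
move=> dt homo.
have step x y z : G x y -> far_rel t (phi x) (phi y) ->
    hamming (phi x) z + hamming (phi y) z <= d + t /\
    d <= hamming (phi x) z + hamming (phi y) z + t.
  move=> Gxy far; split; last first.
    have := hamming_tri (phi x) z (phi y); rewrite [hamming z _]hamming_sym.
    move: far; rewrite /far_rel; lia.
  have := hamming_tri (antipode (phi x)) (phi y) (antipode z).
  have := hamming_antipode (phi y) z; have := hamming_antipode (phi y) (phi x).
  have := hamming_antipode (antipode (phi x)) z.
  have := hamming_antipode z (phi x).
  rewrite [hamming (antipode _) z]hamming_sym [hamming (antipode _) (phi y)]hamming_sym.
  rewrite [hamming z (phi x)]hamming_sym [hamming (phi y) (phi x)]hamming_sym.
  move: far; rewrite /far_rel; lia.
have gstep x y z (Gxy : G x y) := step x y z Gxy (homo x y Gxy).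
have walk x p : path G x p ->
    hamming (phi (last x p)) (phi x) <= size p * t \/
    d <= hamming (phi (last x p)) (phi x) + size p * t.
  elim/last_ind: p => [|p y IH]; first by rewrite hamming_refl; left.
  rewrite rcons_path last_rcons size_rcons => /andP[/IH{}IH Gy].
  have := gstep _ _ (phi x) Gy; case: IH => ? [? ?]; [right|left]; lia.
have csym : connect_sym G by apply: sym_connect_sym; apply: adj_sym.
have close x : hamming (phi x) (phi (fingraph.root G x)) <= #|V| * t \/
    d <= hamming (phi x) (phi (fingraph.root G x)) + #|V| * t.
  have: connect G (fingraph.root G x) x by rewrite csym connect_root.
  move: (fingraph.root G x) => r /connectP[p Gp ->]; case/shortenP: Gp => p' Gp' up' _.
  (* A simple path from the root of the component keeps the error within [#|V| * t]; the edge to be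
     checked costs one more [t]. *)
  have : size p' <= #|V|.
    by have := max_card (mem (r :: p')); rewrite (card_uniqP up') => /ltnW.
  move=> le; have : size p' * t <= #|V| * t by rewrite leq_mul2r le orbT.
  move=> le'; case: (walk _ _ Gp') => le1; [left|right].
    exact: leq_trans le1 le'.
  by apply: leq_trans le1 _; rewrite leq_add2l.
exists [set x | 2 * hamming (phi x) (phi (fingraph.root G x)) < d] => x y Gxy.
have rxy : fingraph.root G y = fingraph.root G x.
  by apply/eqP; rewrite (root_connect csym) csym connect1.
have [] := gstep x y (phi (fingraph.root G x)) Gxy.
have := close x; have := close y; rewrite !inE rxy.
move: (hamming _ _) (hamming _ _) => a b.
by do 2 case: ltnP; lia.
Qed.

(** * Expansion of the nearly antipodal graph *)

Section CubeExpansion.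
Import Order.TTheory GRing.Theory Num.Theory.
Local Open Scope ring_scope.
Definition slice d (S : {set cube d.+1}) (b : bool) : {set cube d} :=
  [set x | (b, x) \in S].

Lemma card_slice d (S : {set cube d.+1}) :
  #|S| = (#|slice S true| + #|slice S false|)%N.
Proof.
rewrite -!sum1_card (eq_bigl (fun x => (x.1, x.2) \in S)); last by case.
rewrite big_mkcond /= -(pair_bigA _ (fun b y => if (b, y) \in S then 1%N else 0%N)) /=.
rewrite big_bool /= -!big_mkcond /=.
by congr (_ + _)%N; apply: eq_bigl => x; rewrite inE.
Qed.

(* In the induction below the products a, b of sizes of opposite slices satisfy
   a b <= K^2, so the loss per dimension is only of second order in th - 1. *)
Lemma cross_sum_le (F : realFieldType) (K th a b : F) :
  0 < K -> 1 <= th -> 0 <= a -> 0 <= b -> a <= th * K -> b <= th * K ->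
  a * b <= K ^+ 2 -> a + b <= (th + th^-1) * K.
Proof.
move=> K0 th1 a0 b0 aK bK abK.
have th0 : 0 < th by lra.
have [lt|ge] := lerP a (th^-1 * K); first by rewrite mulrDl; lra.
have a_gt0 : 0 < a by apply: le_lt_trans ge; rewrite mulr_ge0 ?invr_ge0; lra.
have thV : th * th^-1 = 1 by rewrite divff ?gt_eqF.
rewrite -(ler_pM2r a_gt0).
(* Here [a] lies between [th^-1 * K] and [th * K], and the convex function a + K^2 / a is largest at
   these ends. *)
have : 0 <= (th * K - a) * (a - th^-1 * K) by apply: mulr_ge0; lra.
have -> : (th * K - a) * (a - th^-1 * K) =
   (th + th^-1) * K * a - a * a - (th * th^-1) * K ^+ 2 by ring.
rewrite thV mul1r; lra.
Qed.

(** Slices with equal first coordinate keep distance [D], opposite ones keep [D - 1]. By induction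
    the equal pairs contribute at most [2 * K], and [cross_sum_le] bounds the opposite pairs, which
    produces the base [2 + th + th^-1]. *)
Lemma cube_two_sets (F : realFieldType) (th : F) d (S T : {set cube d}) (D : nat) :
  1 <= th -> (forall x y, x \in S -> y \in T -> (D <= hamming x y)%N) ->
  #|S|%:R * #|T|%:R * th ^+ D <= (2 + th + th^-1) ^+ d.
Proof.
move=> th1.
have th0 : 0 < th by lra.
have thV0 : 0 < th^-1 by rewrite invr_gt0.
elim: d S T D => [|d IH] S T D sep.
  rewrite expr0.
  have [S0|[x xS]] := set_0Vmem S; first by rewrite S0 cards0 !mul0r.
  have [T0|[y yT]] := set_0Vmem T; first by rewrite T0 cards0 mulr0 mul0r.
  have := sep x y xS yT; rewrite /= leqn0 => /eqP->.
  have le1 (A : {set cube 0}) : #|A|%:R <= 1 :> F.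
    by rewrite (ler_nat _ _ 1) -[leqRHS](card_cube 0) max_card.
  rewrite expr0 mulr1 -[leRHS]mulr1.
  by apply: ler_pM.
set be := (2 + th + th^-1).
have be0 : 0 < be by rewrite /be; lra.
pose K := be ^+ d * th ^- D.
have K0 : 0 < K by rewrite mulr_gt0 ?invr_gt0 ?exprn_gt0.
have thD0 : 0 < th ^+ D by rewrite exprn_gt0.
have same b : #|slice S b|%:R * #|slice T b|%:R <= K.
  rewrite ler_pdivlMr //; apply: IH => x y.
  by rewrite !inE => xS yT; have := sep _ _ xS yT; rewrite /= eqxx.
have cross b : #|slice S b|%:R * #|slice T (~~ b)|%:R <= th * K.
  case: D sep @K K0 thD0 same => [|D] sep K K0 thD0 same.
    apply: (@le_trans _ _ K); last by rewrite ler_peMl // ltW.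
    by rewrite /K expr0 invr1 mulr1 -[leLHS]mulr1 -(expr0 th); apply: IH.
  have -> : th * K = be ^+ d / th ^+ D.
    rewrite /K exprS invfM mulrCA (mulrA th) divff ?mul1r //; lra.
  rewrite ler_pdivlMr ?exprn_gt0 //; apply: IH => x y.
  rewrite !inE => xS yT; have := sep _ _ xS yT => /=.
  by case: (b) => /=; lia.
rewrite !card_slice !natrD -ler_pdivlMr // exprS -mulrA -/K.
have := same true; have := same false; have := cross true; have := cross false.
rewrite /=.
set s1 := #|slice S true|%:R; set s0 := #|slice S false|%:R.
set t1 := #|slice T true|%:R; set t0 := #|slice T false|%:R.
have p1 : 0 <= s1 by rewrite ler0n.
have p2 : 0 <= s0 by rewrite ler0n.
have p3 : 0 <= t1 by rewrite ler0n.
have p4 : 0 <= t0 by rewrite ler0n.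
move=> c0 c1 e0 e1.
have : s1 * t0 + s0 * t1 <= (th + th^-1) * K.
  apply: cross_sum_le => //; try exact: mulr_ge0.
  rewrite (_ : s1 * t0 * (s0 * t1) = (s1 * t1) * (s0 * t0)); last by ring.
  by rewrite expr2; apply: ler_pM => //; apply: mulr_ge0.
rewrite /be; lra.
Qed.

(** Without far pairs, [S] and the antipodes of [T] are more than [4 * l * j] apart, and
    [cube_two_sets] bounds the product of their sizes by 4 ^ (d - j), where d is the dimension. *)
Lemma far_rel_expand l j (S T : {set cube (4 * l ^ 2 * j)}) :
  (0 < l)%N ->
  (forall x y, x \in S -> y \in T -> ~~ far_rel (4 * l * j) x y) ->
  (#|S| <= 2 ^ (4 * l ^ 2 * j - j) \/ #|T| <= 2 ^ (4 * l ^ 2 * j - j))%N.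
Proof.
move=> l0; set d := (4 * l ^ 2 * j)%N; set h := (2 ^ _)%N => nfar.
pose L : rat := l%:R.
have L1 : 1 <= L by rewrite (ler_nat _ 1).
(* The loss per dimension is then [be], only of order 1 / L^2 above 1, while each unit of distance
   gains a factor of order 1 / L above 1. The dimension is [l] times the distance, and the constants
   let the gain win. *)
pose th : rat := 1 + L^-1.
have LV0 : 0 < L^-1 by rewrite invr_gt0; lra.
have LV1 : L * L^-1 = 1 by rewrite divff //; lra.
have th1 : 1 <= th by rewrite /th; lra.
pose T' := [set antipode x | x in T].
have cT' : #|T'| = #|T| by rewrite card_imset //; apply: inv_inj; apply: antipodeK.
have sep x y : x \in S -> y \in T' -> (4 * l * j <= hamming x y)%N.
  move=> xS /imsetP[z zT ->]; have := nfar x z xS zT.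
  rewrite /far_rel -ltnNge; have := hamming_antipode x z.
  by move: (hamming x _) (hamming x z) => a b; rewrite -/d; lia.
have := cube_two_sets th1 sep; rewrite cT'.
pose be : rat := 1 + (4 * L * (L + 1))^-1.
have LL0 : 0 < 4 * L * (L + 1) by rewrite mulr_gt0 //; lra.
have bE : 2 + th + th^-1 = 4 * be.
  rewrite /be /th; field; apply/andP; split; lra.
have be1 : 1 <= be by rewrite /be; have := LL0; rewrite -invr_gt0; lra.
have be0 : 0 < be by apply: lt_le_trans be1.
(* Bernoulli's inequality for be^-1. *)
have bel : be ^+ l * (4 * L + 3) <= 4 * L + 4.
  have bern (x : rat) m : 0 <= x <= 1 -> 1 - m%:R * x <= (1 - x) ^+ m.
    move=> /andP[x0 x1]; elim: m => [|m IH]; first by rewrite mul0r subr0 expr0.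
    rewrite exprS; apply: (@le_trans _ _ ((1 - x) * (1 - m%:R * x))).
      rewrite -natr1; have : 0 <= m%:R * x * x by rewrite !mulr_ge0.
      by lra.
    by apply: ler_wpM2l => //; lra.
  have beV : 1 - (4 * L * (L + 1))^-1 <= be^-1.
    rewrite -[be^-1]mul1r ler_pdivlMr // /be.
    have : 0 <= (4 * L * (L + 1))^-1 * (4 * L * (L + 1))^-1 by rewrite mulr_ge0 // invr_ge0 ltW.
    by lra.
  have x1 : (4 * L * (L + 1))^-1 <= 1.
    rewrite invf_le1 //; have : 1 <= L * L by rewrite mulr_ege1.
    by lra.
  have := bern (4 * L * (L + 1))^-1 l; rewrite invr_ge0 ltW // x1 => /(_ isT).
  have -> : l%:R * (4 * L * (L + 1))^-1 = (4 * L + 4)^-1.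
    by rewrite -/L; field; apply/andP; split; lra.
  move=> b1.
  have b2 : (1 - (4 * L * (L + 1))^-1) ^+ l <= be ^- l.
    by rewrite -exprVn lerXn2r // nnegrE ?invr_ge0; lra.
  have := le_trans b1 b2; rewrite -[be ^- l]mul1r ler_pdivlMr ?exprn_gt0 // mulrC.
  rewrite -(ler_pM2r (_ : 0 < 4 * L + 4)); last by lra.
  have -> : be ^+ l * (1 - (4 * L + 4)^-1) * (4 * L + 4) = be ^+ l * (4 * L + 3).
    by field; lra.
  by rewrite mul1r.
have bel0 : 0 < be ^+ l by rewrite exprn_gt0.
have ratio : 1 + 3 / (4 * L) <= th / be ^+ l.
  rewrite ler_pdivlMr // mulrC.
  have -> : be ^+ l * (1 + 3 / (4 * L)) = be ^+ l * (4 * L + 3) / (4 * L) by field; lra.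
  rewrite ler_pdivrMr; last by lra.
  have -> : th * (4 * L) = 4 * L + 4 by rewrite /th; field; lra.
  by [].
(* Bernoulli gives a net gain of 1 + 3 per [4 * l] units of distance, hence the factor [4 ^ j]
   overall. *)
have th_be : 4 <= (th / be ^+ l) ^+ (4 * l).
  have bern (x : rat) m : 0 <= x -> 1 + m%:R * x <= (1 + x) ^+ m.
    move=> x0; elim: m => [|m IH]; first by rewrite mul0r addr0 expr0.
    rewrite exprS; apply: (@le_trans _ _ ((1 + x) * (1 + m%:R * x))).
      rewrite -natr1; have : 0 <= m%:R * x * x by rewrite !mulr_ge0.
      by lra.
    by apply: ler_wpM2l => //; lra.
  have c0 : 0 <= 3 / (4 * L) by rewrite divr_ge0 //; lra.
  apply: (@le_trans _ _ ((1 + 3 / (4 * L)) ^+ (4 * l))); last first.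
    by rewrite lerXn2r // nnegrE; lra.
  apply: le_trans (bern _ _ c0).
  rewrite natrM -/L (_ : 4%:R * L * (3 / (4 * L)) = 3); first by lra.
  by field; lra.
move=> main.
have prod_le : (#|S| * #|T| * 4 ^ j <= 4 ^ d)%N.
  rewrite -(ler_nat rat) !natrM !natrX.
  have := main; rewrite bE exprMn.
  have -> : be ^+ d = (be ^+ l) ^+ (4 * l * j).
    by rewrite -exprM; congr (_ ^+ _); rewrite /d -mulnn -!mulnA (mulnCA l).
  rewrite -ler_pdivlMr ?exprn_gt0 //; last exact: lt_le_trans th1.
  move=> le1; apply: (@le_trans _ _ (#|S|%:R * #|T|%:R * ((th / be ^+ l) ^+ (4 * l)) ^+ j)).
    apply: ler_wpM2l; first by rewrite mulr_ge0.
    by rewrite lerXn2r // nnegrE; lra.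
  rewrite -exprM expr_div_n mulrA ler_pdivrMr ?exprn_gt0 //.
  have th0 : 0 < th by apply: lt_le_trans th1.
  by rewrite -ler_pdivlMr ?exprn_gt0.
case: (leqP #|S| h) => hS; [by left|right].
rewrite leqNgt; apply/negP => hT.
have hj : (h * 2 ^ j = 2 ^ d)%N.
  by rewrite /h -expnD subnK // leq_pmull // muln_gt0 expn_gt0 l0.
have e4 m : (4 ^ m = 2 ^ m * 2 ^ m)%N by rewrite (_ : 4 = 2 * 2)%N // expnMn.
move: prod_le; rewrite !e4 -hj [leqRHS]mulnACA leq_pmul2r ?muln_gt0 ?expn_gt0 // leqNgt.
by rewrite ltn_mul.
Qed.

End CubeExpansion.

(** * Counting labellings without good triples *)

Lemma card_ffun_forall (K X : finType) (D : K -> {set X}) :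
  #|[set z : {ffun K -> X} | [forall k, z k \in D k]]| = \prod_k #|D k|.
Proof.
rewrite (_ : \prod_k _ = #|(family (fun k => mem (D k)) : simpl_pred {ffun K -> X})|).
  by apply: eq_card => z; rewrite inE.
by rewrite card_family foldrE big_map big_enum.
Qed.

Lemma card_sum_bool (K : finType) (P : pred K) : #|[set k | P k]| = \sum_k P k.
Proof. by rewrite -sum1dep_card big_mkcond; apply: eq_bigr => k _; case: (P k). Qed.

(* Markov's inequality for q ^ (number of hits), whose expectation factorises. *)
Lemma card_many_hits (K X : finType) (D : K -> {set X}) (q s : nat) :
  0 < q -> (forall k, #|D k| * q <= #|X|) ->
  #|[set x : {ffun K -> X} | s <= #|[set k | x k \in D k]|]| * q ^ s
    <= (2 * #|X|) ^ #|K|.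
Proof.
move=> q0 Dq.
apply: (@leq_trans (\sum_(x : {ffun K -> X}) \prod_k q ^ (x k \in D k))).
  rewrite -sum_nat_const [leqLHS]big_mkcond /=; apply: leq_sum => x _.
  rewrite inE; case: ifP => // le_s.
  by rewrite -expn_sum -card_sum_bool leq_pexp2l.
rewrite -(bigA_distr_bigA (fun k v => q ^ (v \in D k))) /= -prod_nat_const.
apply: leq_prod => k _; apply: (@leq_trans (\sum_v (1 + (v \in D k) * q))).
  by apply: leq_sum => v _; case: (v \in D k); rewrite ?expn1 ?mul1n ?leq_addl.
rewrite big_split /= sum1_card -big_distrl /= mul2n -addnn leq_add2l.
rewrite -card_sum_bool (_ : [set v | v \in D k] = D k) //.
by apply/setP => v; rewrite inE.
Qed.

Lemma cardsU_le (T : finType) (A B : {set T}) : #|A :|: B| <= #|A| + #|B|.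
Proof. by rewrite leq_card_setU. Qed.

(** A uniform function restricted along an injection is uniform; the two probabilities are compared
    with denominators cleared. *)
Lemma card_restrict (J I X : finType) (g : I -> J) (E : pred {ffun I -> X}) :
  injective g ->
  #|[set f : {ffun J -> X} | E [ffun i => f (g i)]]| * #|X| ^ #|I|
    <= #|X| ^ #|J| * #|[set u | E u]|.
Proof.
move=> g_inj.
pose rest : pred J := [pred k | k \notin codom g].
pose F (f : {ffun J -> X}) := ([ffun k : {k | rest k} => f (val k)], [ffun i => f (g i)]).
have F_inj : injective F.
  move=> f f' [/ffunP e1 /ffunP e2]; apply/ffunP => k.
  case: (boolP (k \in codom g)) => [/codomP[i ->]|nk].
    by have := e2 i; rewrite !ffunE.
  by have := e1 (exist _ k nk); rewrite !ffunE.
have card_rest : #|{: {k | rest k}}| + #|I| = #|J|.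
  by rewrite card_sig -(card_codom g_inj) addnC; apply: cardC.
rewrite -(card_imset _ F_inj) -card_rest expnD mulnAC leq_mul2r; apply/orP; right.
apply: (@leq_trans #|setX [set: {ffun {k | rest k} -> X}] [set u | E u]|); last first.
  by rewrite cardsX cardsT card_ffun.
apply: subset_leq_card; apply/subsetP => _ /imsetP[f Ef ->].
by rewrite !inE in Ef *.
Qed.

(** * Exposing one vertex of C *)

Section StepCount.
Variables (W : finType) (e : rel W) (h j mu : nat).
Hypothesis expand : forall S T : {set W},
  (forall x y, x \in S -> y \in T -> ~~ e x y) -> #|S| <= h \/ #|T| <= h.
Hypothesis hW : h * 2 ^ j = #|W|.
Hypothesis W0 : 0 < #|W|.
Hypothesis muW : 4 * #|W| ^ 3 <= mu.
Hypothesis j33 : 33 <= j.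

Local Notation m := (64 * mu).
Local Notation I := 'I_m.
Local Notation r := #|W|.
Implicit Types (P : I -> I -> {set W * W}) (x y : {ffun I -> W * W}).

(* In [Q : {set W * W}] one reads the labels (f(a,c), f(b,c)) of the vertices c
   seen so far with f(c,a) adjacent to f(c,b); [allowed Q] is then the set of
   values (f(a,b), f(b,a)) creating no edge {a,b,c}. *)
Definition rowset (Q : {set W * W}) (v : W) : {set W} := [set w | (v, w) \in Q].
Definition heavy (Q : {set W * W}) : {set W} := [set v | h < #|rowset Q v|].
Definition full (Q : {set W * W}) := h < #|heavy Q|.
Definition allowed (Q : {set W * W}) : {set W * W} :=
  [set z | [forall p in Q, ~~ (e z.1 p.1 && e z.2 p.2)]].

Lemma card_rowset (Q : {set W * W}) : #|Q| = \sum_v #|rowset Q v|.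
Proof.
rewrite -sum1_card (eq_bigl (fun z => (z.1, z.2) \in Q)); last by case.
rewrite big_mkcond /= -(pair_bigA _ (fun v w => if (v, w) \in Q then 1 else 0)) /=.
by apply: eq_bigr => v _; rewrite -big_mkcond /= sum1dep_card.
Qed.

(** Expansion is used twice. An edge from a heavy row of [allowed Q] to a heavy row of [Q] would
    join two rows of more than [h] elements, and these span an edge that [allowed] excludes. So
    [allowed Q] has at most [h] heavy rows. *)
Lemma allowed_full (Q : {set W * W}) : full Q -> #|allowed Q| <= 2 * h * r.
Proof.
move=> fQ.
have le_h : #|heavy (allowed Q)| <= h.
  have [|//|] := @expand (heavy (allowed Q)) (heavy Q); last first.
    by rewrite leqNgt (fQ : h < _).
  move=> a g; rewrite !inE => ha hg; apply/negP => eag.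
  have [|le|le] := @expand (rowset (allowed Q) a) (rowset Q g).
  - move=> b g'; rewrite !inE => /forall_inP aQ gQ.
    by have := aQ _ gQ; rewrite /= eag.
  - by rewrite ltnNge le in ha.
  - by rewrite ltnNge le in hg.
rewrite card_rowset (bigID (mem (heavy (allowed Q)))) /= -mulnA mul2n -addnn.
apply: leq_add.
  apply: (@leq_trans (\sum_(v in heavy (allowed Q)) r)).
    by apply: leq_sum => v _; apply: max_card.
  by rewrite sum_nat_const leq_mul2r le_h orbT.
apply: (@leq_trans (\sum_(v | v \notin heavy (allowed Q)) h)).
  by apply: leq_sum => v; rewrite inE -leqNgt.
by rewrite sum_nat_const mulnC leq_mul2l max_card orbT.
Qed.

Definition unfull P (b : I) : {set I} := [set a | ~~ full (P a b)].

(** Conditions on the labels (f(c,a), f(a,c)) alone: few f(a,c) fall in heavy rows of unfull sets,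
    and no [h] values collect many of the f(c,a). *)
Definition typical P x :=
  (forall b, #|[set a in unfull P b | (x a).2 \in heavy (P a b)]| < 4 * mu) /\
  (forall V' : {set W}, #|V'| <= h -> #|[set a | (x a).1 \in V']| < 4 * mu).

Definition added P x b (z : W * W) : {set I} :=
  [set a | e (x a).1 z.1 & ((x a).2, z.2) \notin P a b].

Definition cheap P x b : {set W * W} :=
  [set z | #|added P x b z| < 16 * r ^ 2].

(** Fix the second coordinate [w]. Unless [w] is busy, many sets [P a b] can still grow, and the
    first labels of these [a] take more than [h] popular values. A cheap first coordinate has no
    edge from a popular value, so expansion leaves at most [h] of them. *)
Lemma card_cheap P x b : typical P x -> 16 * mu <= #|unfull P b| ->
  #|cheap P x b| <= 17 * (h * r).
Proof.
move=> [typ1 typ2] leZ.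
have mu0 : 0 < mu by have : 0 < r ^ 3 := _; rewrite ?expn_gt0 ?W0 //; lia.
pose light := [set a in unfull P b | (x a).2 \notin heavy (P a b)].
pose hits w := [set a in light | ((x a).2, w) \in P a b].
pose busy := [set w | 4 * mu <= #|hits w|].
(* Double counting: at most [m] light rows with at most [h] entries each, against [4 * mu] hits per
   busy value. *)
have card_busy : #|busy| <= 16 * h.
  rewrite -(leq_pmul2r (_ : 0 < 4 * mu)); last by lia.
  rewrite -sum_nat_const.
  apply: (@leq_trans (\sum_w #|hits w|)).
    rewrite big_mkcond /=; apply: leq_sum => w _; rewrite inE.
    by case: ifP.
  have -> : \sum_w #|hits w| = \sum_(a in light) #|rowset (P a b) (x a).2|.
    under eq_bigr do rewrite -sum1dep_card.
    rewrite (exchange_big_dep (mem light)) /=; last by move=> w a _ /andP[].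
    apply: eq_bigr => a aL; rewrite sum1dep_card; apply: eq_card => w.
    by move: aL; rewrite !inE => ->.
  apply: (@leq_trans (\sum_(a in light) h)).
    by apply: leq_sum => a; rewrite !inE -leqNgt => /andP[].
  have le_m : #|light| <= m by rewrite -[leqRHS]card_ord max_card.
  by rewrite sum_nat_const; apply: leq_trans (leq_mul le_m (leqnn h)) _; lia.
rewrite card_rowset.
have -> : \sum_v #|rowset (cheap P x b) v| =
    \sum_w #|[set v | (v, w) \in cheap P x b]|.
  under eq_bigr do rewrite -sum1dep_card.
  rewrite (exchange_big_dep predT) //=.
  by apply: eq_bigr => w _; rewrite sum1dep_card.
rewrite (bigID (mem busy)) /= (_ : 17 * (h * r) = 16 * h * r + h * r); last by lia.
apply: leq_add.
  apply: (@leq_trans (\sum_(w in busy) r)).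
    by apply: leq_sum => w _; apply: max_card.
  by rewrite sum_nat_const leq_mul2r card_busy orbT.
apply: (@leq_trans (\sum_(w | w \notin busy) h)); last first.
  by rewrite sum_nat_const mulnC leq_mul2l max_card orbT.
apply: leq_sum => w; rewrite inE -ltnNge => few.
pose Q := [set a in unfull P b | ((x a).2, w) \notin P a b].
have card_Q : 8 * mu < #|Q|.
  pose hv := [set a in unfull P b | (x a).2 \in heavy (P a b)].
  have sub : unfull P b \subset hv :|: hits w :|: Q.
    apply/subsetP => a; rewrite !inE => ->.
    by case: (_ < _); case: (_ \in P a b).
  have := subset_leq_card sub; have := typ1 b; rewrite -/hv.
  have : #|hv :|: hits w :|: Q| <= #|hv :|: hits w| + #|Q| by rewrite leq_card_setU.
  have : #|hv :|: hits w| <= #|hv| + #|hits w| by rewrite leq_card_setU.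
  by lia.
pose pop := [set v | 16 * r ^ 2 <= #|[set a in Q | (x a).1 == v]|].
(* Otherwise typicality leaves fewer than [4 * mu] indices to popular values, and the other values
   carry at most [16 * r ^ 3 <= 4 * mu]. *)
have card_pop : h < #|pop|.
  rewrite ltnNge; apply/negP => /typ2 t2.
  have c1 : #|Q :\: [set a | (x a).1 \in pop]| <= r * (16 * r ^ 2).
    rewrite -sum1_card (partition_big (fun a => (x a).1) predT) //=.
    rewrite -sum_nat_const; apply: leq_sum => v _.
    rewrite sum1dep_card; case: (boolP (v \in pop)) => [vp|].
      rewrite (_ : [set _ | _] = set0) ?cards0 //; apply/setP => a; rewrite !inE.
      apply/negP => /andP[/andP[np _] /eqP xv]; move: np vp; rewrite !inE xv => /negP.
      by [].
    rewrite inE -ltnNge => /ltnW; apply: leq_trans.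
    apply: subset_leq_card; apply/subsetP => a; rewrite !inE.
    by case/andP => /andP[_ ->] ->.
  have c2 := cardsID [set a | (x a).1 \in pop] Q.
  have c3 := subset_leq_card (subsetIr Q [set a | (x a).1 \in pop]).
  have c4 : r * (16 * r ^ 2) = 4 * (4 * r ^ 3) by rewrite (expnS _ 2); lia.
  move: c1 c2 c3 t2 card_Q muW; rewrite c4.
  by move: #|_ :\: _| #|_ :&: _| #|Q| #|[set a | _]| (r ^ 3); lia.
have [|//|] := @expand pop [set v | (v, w) \in cheap P x b]; last first.
- by [].
- by rewrite leqNgt card_pop.
move=> v v'; rewrite !inE => pv cv; apply/negP => evv'.
move: cv; rewrite ltnNge; apply/negP; rewrite negbK; apply: leq_trans pv _.
apply: subset_leq_card; apply/subsetP => a; rewrite !inE.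
by case/andP => /andP[_ ->] /eqP ->; rewrite evv'.
Qed.

(** Two averages: with more than half of the pairs unfull, [16 * mu] indices [b] have many unfull
    sets; each label that is not cheap adds [16 * r ^ 2], so at most [8 * mu] of these are
    affordable. *)
Lemma many_cheap P x y :
  \sum_b #|added P x b (y b)| < 128 * mu * r ^ 2 ->
  m ^ 2 < 2 * \sum_b #|unfull P b| ->
  8 * mu <= #|[set b | (16 * mu <= #|unfull P b|) && (y b \in cheap P x b)]|.
Proof.
move=> few half.
pose B := [set b | 16 * mu <= #|unfull P b|].
pose N := [set b | y b \notin cheap P x b].
have cardB : 16 * mu <= #|B|.
  have : \sum_b #|unfull P b| <= #|B| * m + m * (16 * mu).
    rewrite (bigID (mem B)) /=; apply: leq_add.
      rewrite -sum_nat_const; apply: leq_sum => b _.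
      by rewrite -[leqRHS]card_ord max_card.
    apply: (@leq_trans (\sum_(b | b \notin B) 16 * mu)).
      by apply: leq_sum => b; rewrite inE -ltnNge => /ltnW.
    by rewrite sum_nat_const leq_mul2r -[leqRHS]card_ord max_card orbT.
  move: half; rewrite -mulnn; move: (\sum_b _) #|B| => u v; nia.
have cardN : #|N| <= 8 * mu.
  have : #|N| * (16 * r ^ 2) <= \sum_b #|added P x b (y b)|.
    rewrite -sum_nat_const big_mkcond /=; apply: leq_sum => b _.
    by rewrite !inE -leqNgt; case: ifP.
  have r2 : 0 < r ^ 2 by rewrite expn_gt0 W0.
  move: few; move: (\sum_b _) #|N| (r ^ 2) r2 => u v w; nia.
have : B \subset N :|: [set b | (16 * mu <= #|unfull P b|) && (y b \in cheap P x b)].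
  by apply/subsetP => b; rewrite !inE => ->; case: (_ < _).
move/subset_leq_card => le1; have := leq_trans le1 (cardsU_le _ _).
by move: cardB cardN; move: #|B| #|N| #|[set b | _ && _]|; lia.
Qed.

(** A calm [y] hits cheap sets at [8 * mu] indices. The exponent [j - 5] arises because the constant
    17 of [card_cheap] is at most [2 ^ 5]. *)
Lemma few_calm_typical P x : typical P x -> m ^ 2 < 2 * \sum_b #|unfull P b| ->
  #|[set y : {ffun I -> W * W} | \sum_b #|added P x b (y b)| < 128 * mu * r ^ 2]|
    * 2 ^ (8 * mu * (j - 5)) <= (2 * r ^ 2) ^ m.
Proof.
move=> typ half.
pose D b := if 16 * mu <= #|unfull P b| then cheap P x b else set0.
have DX b : #|D b| * 2 ^ (j - 5) <= #|{: W * W}|.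
  rewrite /D; case: ifP => [Zb|_]; last by rewrite cards0.
  rewrite card_prod; apply: leq_trans (leq_mul (card_cheap typ Zb) (leqnn _)) _.
  rewrite -{2}hW mulnAC (mulnC h) -[j in leqRHS](subnK (_ : 5 <= j)); last by lia.
  by rewrite expnD; move: (2 ^ (j - 5)) => u; nia.
have := card_many_hits (8 * mu) (_ : 0 < 2 ^ (j - 5)) DX.
rewrite expn_gt0 /= card_prod mulnn card_ord -expnM [(j - 5) * _]mulnC => /(_ isT).
apply: leq_trans; rewrite leq_mul2r; apply/orP; right.
apply: subset_leq_card; apply/subsetP => y; rewrite !inE => calm.
apply: leq_trans (many_cheap calm half) _; apply: subset_leq_card.
by apply/subsetP => b; rewrite !inE /D => /andP[->]; rewrite inE.
Qed.

(** Union bound over [m] indices [b] and [2 ^ r] sets [V']; each violation means [4 * mu] hits of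
    sets of density at most 1 / 2 ^ j. *)
Lemma few_atypical P :
  #|[set x : {ffun I -> W * W} | ~~ `[< typical P x >]]| * 2 ^ (4 * mu * j)
    <= (m + 2 ^ r) * (2 * r ^ 2) ^ m.
Proof.
pose D1 b a := if a \in unfull P b then [set z : W * W | z.2 \in heavy (P a b)] else set0.
pose D2 (V' : {set W}) (a : I) :=
  if #|V'| <= h then [set z : W * W | z.1 \in V'] else set0.
pose A1 b := [set x : {ffun I -> W * W} | 4 * mu <= #|[set a | x a \in D1 b a]|].
pose A2 V' := [set x : {ffun I -> W * W} | 4 * mu <= #|[set a | x a \in D2 V' a]|].
have bnd (D : I -> {set W * W}) : (forall a, #|D a| <= h * r) ->
    #|[set x : {ffun I -> W * W} | 4 * mu <= #|[set a | x a \in D a]|]|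
      * 2 ^ (4 * mu * j) <= (2 * r ^ 2) ^ m.
  move=> Dh; rewrite mulnC [4 * mu * j]mulnC expnM mulnC.
  have := @card_many_hits I (W * W)%type D (2 ^ j) (4 * mu).
  rewrite card_prod card_ord mulnn expn_gt0; apply => // a.
  apply: leq_trans (leq_mul (Dh a) (leqnn _)) _.
  by rewrite mulnAC hW mulnn.
have bnd1 b : #|A1 b| * 2 ^ (4 * mu * j) <= (2 * r ^ 2) ^ m.
  apply: bnd => a; rewrite /D1; case: ifP => [|_]; last by rewrite cards0.
  rewrite inE -leqNgt => le_h.
  rewrite (_ : [set z | _] = setX setT (heavy (P a b))); last first.
    by apply/setP => z; rewrite !inE.
  by rewrite cardsX cardsT mulnC leq_mul2r le_h orbT.
have bnd2 V' : #|A2 V'| * 2 ^ (4 * mu * j) <= (2 * r ^ 2) ^ m.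
  apply: bnd => a; rewrite /D2; case: ifP => [le_h|_]; last by rewrite cards0.
  rewrite (_ : [set z | _] = setX V' setT); last first.
    by apply/setP => z; rewrite !inE andbT.
  by rewrite cardsX cardsT leq_mul2r le_h orbT.
have bigU (J : finType) (A : J -> {set {ffun I -> W * W}}) :
    #|\bigcup_k A k| <= \sum_k #|A k|.
  elim/big_rec2: _ => [|k u B _ le]; first by rewrite cards0.
  by apply: leq_trans (cardsU_le _ _) _; rewrite leq_add2l.
have sub : [set x : {ffun I -> W * W} | ~~ `[< typical P x >]]
    \subset (\bigcup_b A1 b) :|: (\bigcup_V' A2 V').
  apply/subsetP => x; rewrite !inE; apply: contraR; rewrite negb_or => /andP[n1 n2].
  apply/asboolP; split.
    move=> b; rewrite ltnNge; apply: contra n1 => le.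
    apply/bigcupP; exists b => //; rewrite inE; apply: leq_trans le _.
    apply: subset_leq_card; apply/subsetP => a; rewrite /D1 !inE => /andP[-> ?].
    by rewrite !inE.
  move=> V' cV'; rewrite ltnNge; apply: contra n2 => le.
  apply/bigcupP; exists V' => //; rewrite inE; apply: leq_trans le _.
  by apply: subset_leq_card; apply/subsetP => a; rewrite /D2 cV' !inE.
apply: (@leq_trans ((\sum_b #|A1 b| + \sum_V' #|A2 V'|) * 2 ^ (4 * mu * j))).
  rewrite leq_mul2r; apply/orP; right; apply: leq_trans (subset_leq_card sub) _.
  by apply: leq_trans (cardsU_le _ _) _; apply: leq_add; apply: bigU.
rewrite mulnDl mulnDl !big_distrl /=; apply: leq_add.
  apply: (@leq_trans (\sum_(b : I) (2 * r ^ 2) ^ m)); last first.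
    by rewrite sum_nat_const card_ord.
  by apply: leq_sum => b _; apply: bnd1.
apply: (@leq_trans (\sum_(V' : {set W}) (2 * r ^ 2) ^ m)); last first.
  have cW : #|{: {set W}}| = 2 ^ r by rewrite -(cardsT W) -card_powerset powersetT cardsT.
  by rewrite sum_nat_const cW.
by apply: leq_sum => V' _; apply: bnd2.
Qed.

(* The labels exposed with c: the first function is a |-> (f(c,a), f(a,c)), the
   second is b |-> (f(c,b), f(b,c)). *)
Definition step : finType := ({ffun I -> W * W} * {ffun I -> W * W})%type.

Definition update P (s : step) : I -> I -> {set W * W} := fun a b =>
  if e (s.1 a).1 (s.2 b).1 then ((s.1 a).2, (s.2 b).2) |: P a b else P a b.

Definition total P := \sum_b \sum_a #|P a b|.

Lemma card_step : #|step| = r ^ (4 * m).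
Proof.
rewrite card_prod card_ffun card_prod card_ord !mulnn -!expnM.
by congr (_ ^ _); lia.
Qed.

Lemma total_update P s :
  total (update P s) = total P + \sum_b #|added P s.1 b (s.2 b)|.
Proof.
rewrite /total -big_split /=; apply: eq_bigr => b _.
rewrite /added card_sum_bool -big_split /=; apply: eq_bigr => a _.
rewrite /update; case: (e _ _) => /=; last by rewrite addn0.
by rewrite cardsU1 addnC.
Qed.

Lemma total_le P : total P <= m ^ 2 * r ^ 2.
Proof.
apply: (@leq_trans (\sum_(b : I) \sum_(a : I) r ^ 2)).
  apply: leq_sum => b _; apply: leq_sum => a _.
  by apply: leq_trans (max_card _) _; rewrite card_prod mulnn.
by rewrite !sum_nat_const card_ord mulnA mulnn.
Qed.

(* A step is calm when it enlarges the sets P a b by less than 128 mu r^2 in total;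
   as their total size is at most (m r)^2, at most m / 2 steps are not calm. *)
Lemma few_calm P : m ^ 2 < 2 * \sum_b #|unfull P b| ->
  #|[set s | total (update P s) < total P + 128 * mu * r ^ 2]|
    * 2 ^ (4 * mu * (j - 33)) <= r ^ (4 * m).
Proof.
move=> half.
have r3 : 0 < r ^ 3 by rewrite expn_gt0 W0.
have mu0 : 0 < mu by lia.
pose calm x := [set y : {ffun I -> W * W} |
  \sum_b #|added P x b (y b)| < 128 * mu * r ^ 2].
pose U := 2 ^ (4 * mu * (j - 33)).
pose X := (r ^ 2) ^ m.
have X_typ x : typical P x -> 2 * (#|calm x| * U) <= X.
  move=> typ; have := few_calm_typical typ half; rewrite -/(calm x) expnMn -/X.
  (* Of the surplus, [m] cancels the factor [2 ^ m] and the positive rest pays for the factor 2. *)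
  have -> : 8 * mu * (j - 5) = 4 * mu * (j - 33) + (4 * mu * (j - 33) + 159 * mu + mu + m).
    by rewrite (_ : j - 5 = j - 33 + 28); [move: (j - 33); lia | lia].
  rewrite expnD -/U (expnD _ _ m) !mulnA.
  rewrite [2 ^ m * X]mulnC leq_pmul2r ?expn_gt0 //.
  apply: leq_trans; rewrite -[2 * _ * U]mulnA [leqLHS]mulnC leq_mul2l; apply/orP; right.
  by rewrite -{1}(expn1 2) leq_exp2l // addn_gt0 mu0 orbT.
have X_atyp : 2 * (#|[set x : {ffun I -> W * W} | ~~ `[< typical P x >]]| * U) <= X.
  have := few_atypical P; rewrite expnMn -/X.
  (* Source of the constant 33: [4 * 33 * mu] is [68 * mu + m], where [m] cancels [2 ^ m] and
     [68 * mu] pays for the union bound. *)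
  have -> : 4 * mu * j = 4 * mu * (j - 33) + (68 * mu + m).
    by rewrite -{1}(subnK j33); move: (j - 33); lia.
  have two : 2 * (m + 2 ^ r) <= 2 ^ (68 * mu).
    have lt_m : m <= 2 ^ (64 * mu) by apply/ltnW/ltn_expl.
    have lt_r : 2 ^ r <= 2 ^ (64 * mu).
      rewrite leq_exp2l //; apply: (@leq_trans (r ^ 3)); last by lia.
      by rewrite -{1}(expn1 r) leq_pexp2l.
    have v4 : 4 <= 2 ^ (4 * mu) by apply: (@leq_trans (2 ^ 2)) => //; rewrite leq_exp2l //; lia.
    rewrite (_ : 68 * mu = 64 * mu + 4 * mu) ?(expnD 2 (64 * mu) (4 * mu)); last by lia.
    apply: leq_trans _ (leq_mul (leqnn _) v4).
    by move: (2 ^ (64 * mu)) (2 ^ r) lt_m lt_r; lia.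
  rewrite (expnD 2 (4 * mu * (j - 33))) (expnD 2 (68 * mu)) -/U.
  move: (2 ^ (68 * mu)) two (expn_gt0 2 (68 * mu)) => E two E0.
  rewrite (mulnA U) (mulnCA (m + _)) mulnA mulnC leq_pmul2l ?expn_gt0 // => le.
  rewrite -(leq_pmul2r (_ : 0 < E)); last by nia.
  apply: (@leq_trans (2 * ((m + 2 ^ r) * X))); first by rewrite -mulnA leq_mul2l /= -mulnA.
  by rewrite mulnA mulnC leq_mul2l two orbT.
pose A := [set x : {ffun I -> W * W} | ~~ `[< typical P x >]].
have cX : #|{: {ffun I -> W * W}}| = X by rewrite card_ffun card_prod card_ord mulnn.
have -> : #|[set s | total (update P s) < total P + 128 * mu * r ^ 2]| = \sum_x #|calm x|.
  rewrite -sum1dep_card (eq_bigl (fun s : step => s.2 \in calm s.1)); last first.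
    by move=> s; rewrite total_update ltn_add2l inE.
  rewrite big_mkcond -(pair_bigA _ (fun x y => if y \in calm x then 1 else 0)) /=.
  by apply: eq_bigr => x _; rewrite -big_mkcond sum1_card.
have eX : 2 * r ^ (4 * m) = X * X + X * X.
  by rewrite addnn mul2n /X -expnMn mulnn -!expnM; congr (_ ^ _).*2; lia.
rewrite -(leq_pmul2l (_ : 0 < 2)) // eX (bigID (mem A)) /= mulnDl mulnDr.
apply: leq_add.
  apply: leq_trans _ (leq_mul X_atyp (leqnn X)); rewrite -(mulnA 2) leq_mul2l /= -/U [leqRHS]mulnAC.
  rewrite leq_mul2r; apply/orP; right.
  rewrite -cX -sum_nat_const; apply: leq_sum => x _; exact: max_card.
rewrite big_distrl big_distrr /=.
apply: (@leq_trans (\sum_(x | x \notin A) X)).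
  by apply: leq_sum => x; rewrite inE negbK => /asboolP /X_typ.
by rewrite sum_nat_const leq_mul2r -[leqRHS]cX max_card orbT.
Qed.

(** * Counting whole sequences of steps *)

Definition compatible P (z : {ffun I * I -> W * W}) :=
  [forall p, z p \in allowed (P p.1 p.2)].

Fixpoint bad_count (k : nat) P : nat :=
  if k is k'.+1 then \sum_(s : step) bad_count k' (update P s)
  else #|[set z | compatible P z]|.

Lemma compatible_update P s z : compatible (update P s) z -> compatible P z.
Proof.
move/forallP => cz; apply/forallP => p; have := cz p; rewrite !inE.
move/forall_inP => a; apply/forall_inP => w wP; apply: a.
by rewrite /update; case: (e _ _); rewrite // inE wP orbT.
Qed.

Lemma bad_count_le k P :
  bad_count k P <= r ^ (4 * m * k) * #|[set z | compatible P z]|.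
Proof.
elim: k P => [|k IH] P /=; first by rewrite muln0 expn0 mul1n.
rewrite mulnS expnD -card_step -mulnA -sum_nat_const; apply: leq_sum => s _.
apply: leq_trans (IH _) _; rewrite leq_mul2l subset_leq_card ?orbT //.
by apply/subsetP => z; rewrite !inE; apply: compatible_update.
Qed.

(** At least [2048 * mu ^ 2], half of [m ^ 2], of the sets are full, and each saves a factor
    [2 ^ (j - 1)] by [allowed_full]. *)
Lemma compatible_half P : 2 * \sum_b #|unfull P b| <= m ^ 2 ->
  #|[set z | compatible P z]| * 2 ^ ((j - 1) * (2048 * mu ^ 2)) <= r ^ (2 * m ^ 2).
Proof.
move=> half.
rewrite card_ffun_forall.
apply: (@leq_trans (\prod_(p : I * I) #|allowed (P p.1 p.2)| *
   2 ^ ((j - 1) * \sum_(p : I * I) full (P p.1 p.2)))).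
  rewrite leq_mul2l leq_exp2l // leq_mul2l; apply/orP; right; apply/orP; right.
  have : \sum_(p : I * I) full (P p.1 p.2) + \sum_b #|unfull P b| = m ^ 2.
    rewrite -(pair_bigA _ (fun a b => (full (P a b) : nat))) /= exchange_big /=.
    rewrite -big_split /=.
    under eq_bigr => b _.
      rewrite /unfull card_sum_bool -big_split /=.
      under eq_bigr => a _ do rewrite addnC addn_negb.
      over.
    by rewrite !sum_nat_const card_ord muln1 mulnn.
  by move: half; rewrite expnMn; move: (\sum_p _) (\sum_b _) (mu ^ 2); lia.
rewrite expnM expn_sum -big_split /=.
apply: (@leq_trans (\prod_(p : I * I) r ^ 2)); last first.
  by rewrite prod_nat_const card_prod card_ord mulnn -expnM mulnC.
apply: leq_prod => p _; case: (boolP (full _)) => [fp|_]; last first.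
  by rewrite expn0 muln1; apply: leq_trans (max_card _) _; rewrite card_prod mulnn.
rewrite expn1; apply: leq_trans (leq_mul (allowed_full fp) (leqnn _)) _.
rewrite -mulnn -{2}hW -{2}(subnK (_ : 1 <= j)); last by lia.
by rewrite addn1 expnS; move: (2 ^ _) => u; lia.
Qed.

(** Here [i] bounds the steps that may still fail to be calm, since each of them uses up
    [128 * mu * r ^ 2] of the room left for [total P]. So at least [k - i] steps are calm, unless
    half of the sets become full first; [2 ^ k] pays for the choice of the calm steps. *)
Lemma bad_count_bound k i P :
  m ^ 2 * r ^ 2 <= total P + i * (128 * mu * r ^ 2) -> k <= i + 32 * mu ->
  bad_count k P * 2 ^ (4 * mu * (j - 33) * (k - i))
    <= 2 ^ k * (r ^ (4 * m * k) * r ^ (2 * m ^ 2)).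
Proof.
have r3 : 0 < r ^ 3 by rewrite expn_gt0 W0.
have r2 : 0 < r ^ 2 by rewrite expn_gt0 W0.
have mu0 : 0 < mu by lia.
have card_compat Q : #|[set z | compatible Q z]| <= r ^ (2 * m ^ 2).
  apply: leq_trans (max_card _) _.
  by rewrite card_ffun !card_prod card_ord !mulnn -expnM.
elim: k i P => [|k IH] i P tot ki.
  by rewrite sub0n !muln0 !expn0 muln1 !mul1n; apply: card_compat.
case: (leqP (2 * \sum_b #|unfull P b|) (m ^ 2)) => half.
  (* Half of the sets are full: [compatible_half] alone yields the saving, as at most [32 * mu] calm
     steps are still claimed. *)
  apply: (@leq_trans (r ^ (4 * m * k.+1) * r ^ (2 * m ^ 2))); last first.
    by rewrite leq_pmull // expn_gt0.
  apply: leq_trans (leq_mul (bad_count_le _ _) (leqnn _)) _.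
  rewrite -mulnA leq_mul2l; apply/orP; right.
  apply: leq_trans (compatible_half half).
  rewrite leq_mul2l leq_exp2l //; apply/orP; right.
  apply: (@leq_trans (4 * mu * (j - 33) * (32 * mu))).
    by rewrite leq_mul2l; apply/orP; right; lia.
  rewrite (_ : 4 * mu * (j - 33) * (32 * mu) = (j - 33) * (128 * mu ^ 2)); last first.
    by rewrite -mulnn; move: (j - 33); lia.
  by apply: leq_mul; lia.
pose calm := [set s | total (update P s) < total P + 128 * mu * r ^ 2].
pose y := 2 ^ (4 * mu * (j - 33)).
pose B := 2 ^ k * (r ^ (4 * m * k) * r ^ (2 * m ^ 2)).
have -> : 2 ^ k.+1 * (r ^ (4 * m * k.+1) * r ^ (2 * m ^ 2)) =
    r ^ (4 * m) * B + r ^ (4 * m) * B.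
  by rewrite mulnS expnS (expnD r) /B addnn -mul2n; lia.
rewrite /= (bigID (mem calm)) /= mulnDl; apply: leq_add.
  apply: (@leq_trans (#|calm| * y * B)); last first.
    by rewrite leq_mul2r (few_calm half) orbT.
  apply: (@leq_trans (\sum_(s in calm) y * B)); last by rewrite sum_nat_const mulnA.
  rewrite big_distrl /=; apply: leq_sum => s _.
  apply: (@leq_trans (bad_count k (update P s) * (y * 2 ^ (4 * mu * (j - 33) * (k - i))))).
    rewrite leq_mul2l /y -expnD -mulnS leq_exp2l // leq_mul2l; apply/orP; right.
    by apply/orP; right; lia.
  rewrite mulnCA leq_mul2l; apply/orP; right.
  case: (leqP k (i + 32 * mu)) => ki'; last by lia.
  by apply: IH => //; rewrite total_update; lia.
apply: (@leq_trans (\sum_(s | s \notin calm) B)); last first.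
  by rewrite sum_nat_const leq_mul2r -card_step max_card orbT.
rewrite big_distrl /=; apply: leq_sum => s; rewrite inE -leqNgt => grow.
(* For [i = 0] a step that is not calm would push [total] beyond its maximum. *)
case: i tot ki => [|i] tot ki.
  by have := total_le (update P s); nia.
rewrite subSS; apply: IH; last by lia.
by move: tot; rewrite mulSn; lia.
Qed.

(** At most [32 * mu], half of the [m] steps, can fail to be calm, since [32 * mu * (128 * mu)] is
    [m ^ 2]. *)
Lemma bad_count_empty :
  bad_count m (fun _ _ => set0) * 2 ^ (128 * mu ^ 2 * (j - 33))
    <= 2 ^ m * r ^ (6 * m ^ 2).
Proof.
have := @bad_count_bound m (32 * mu) (fun _ _ => set0).
rewrite (_ : m - 32 * mu = 32 * mu); last by lia.
rewrite (_ : 4 * mu * (j - 33) * (32 * mu) = 128 * mu ^ 2 * (j - 33)); last first.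
  by rewrite -mulnn; move: (j - 33); lia.
rewrite -expnD (_ : 4 * m * m + 2 * m ^ 2 = 6 * m ^ 2); last by rewrite -mulnn; lia.
apply; last by lia.
by rewrite expnMn -!mulnn; move: (total _); lia.
Qed.

Lemma card_bad k P :
  #|[set tz : k.-tuple step * {ffun I * I -> W * W} |
      compatible (foldl update P tz.1) tz.2]| = bad_count k P.
Proof.
rewrite -sum1dep_card big_mkcond /=.
rewrite -(pair_bigA _ (fun (t : k.-tuple step) z =>
   if compatible (foldl update P t) z then 1 else 0)) /=.
transitivity (\sum_(t : k.-tuple step) #|[set z | compatible (foldl update P t) z]|).
  by apply: eq_bigr => t _; rewrite -big_mkcond sum1dep_card.
elim: k P => [|k IH] P /=.
  rewrite (big_pred1 [tuple]) //= => t; apply/esym/eqP; exact: tuple0.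
transitivity (\sum_(s : step) \sum_(t : k.-tuple step)
    #|[set z | compatible (foldl update (update P s) t) z]|); last first.
  by apply: eq_bigr => s _; apply: IH.
rewrite pair_bigA /=.
rewrite (reindex (fun p : step * k.-tuple step => [tuple of p.1 :: p.2])) //=.
exists (fun t => (thead t, [tuple of behead t])) => [[s t] _|t _] /=.
  by rewrite theadE; congr pair; apply: val_inj.
by apply: val_inj; rewrite /= [in RHS](tuple_eta t).
Qed.

(** * From labellings to exposure sequences *)

Local Notation U := (I + I + I)%type.
Local Notation pos := ((I * (I * (bool * bool))) + ((I * I) * bool))%type.

(* The three summands of U are A, B and C; [place] sends a label of [step] or of
   the final pair function to the ordered pair of vertices carrying it. *)
Definition place (p : pos) : U * U :=
  match p with
  | inl (c, (i, (false, false))) => (inr c, inl (inl i))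
  | inl (c, (i, (false, true))) => (inl (inl i), inr c)
  | inl (c, (i, (true, false))) => (inr c, inl (inr i))
  | inl (c, (i, (true, true))) => (inl (inr i), inr c)
  | inr ((a, b), false) => (inl (inl a), inl (inr b))
  | inr ((a, b), true) => (inl (inr b), inl (inl a))
  end.

Lemma place_inj : injective place.
Proof.
by move=> [[c [i [[] []]]]|[[a b] []]] [[c' [i' [[] []]]]|[[a' b'] []]] //= [-> ->].
Qed.

Definition decode (u : {ffun pos -> W}) :
    m.-tuple step * {ffun I * I -> W * W} :=
  ([tuple ([ffun a => (u (inl (c, (a, (false, false)))), u (inl (c, (a, (false, true)))))],
           [ffun b => (u (inl (c, (b, (true, false)))), u (inl (c, (b, (true, true)))))])
          : step | c < m],
   [ffun p => (u (inr (p, false)), u (inr (p, true)))]).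

Lemma decode_step u c : tnth (decode u).1 c =
  ([ffun a => (u (inl (c, (a, (false, false)))), u (inl (c, (a, (false, true)))))],
   [ffun b => (u (inl (c, (b, (true, false)))), u (inl (c, (b, (true, true)))))]).
Proof. by rewrite tnth_mktuple. Qed.

Lemma decode_inj : injective decode.
Proof.
move=> u u' eq_uu'; apply/ffunP.
have e1 c := congr1 (fun tz => tnth tz.1 c) eq_uu'.
have /ffunP e2 := congr1 (fun tz => tz.2) eq_uu'.
move=> [[c [i [b1 b2]]]|[p b]]; last first.
  by have := e2 p; rewrite !ffunE => -[]; case: b.
have := e1 c; rewrite !decode_step => -[/ffunP/(_ i) + /ffunP/(_ i)].
by rewrite !ffunE => -[? ?] [? ?]; case: b1; case: b2.
Qed.

Definition bad_code (u : {ffun pos -> W}) :=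
  compatible (foldl update (fun _ _ => set0) (decode u).1) (decode u).2.

Lemma card_bad_code : #|[set u | bad_code u]| <= bad_count m (fun _ _ => set0).
Proof.
rewrite -card_bad -(card_imset _ decode_inj); apply: subset_leq_card.
by apply/subsetP => tz /imsetP[u]; rewrite inE => bu ->; rewrite inE.
Qed.

Lemma mem_foldl_update (t : seq step) P a b p :
  p \in foldl update P t a b -> p \in P a b \/
  exists2 s : step, s \in t & e (s.1 a).1 (s.2 b).1 /\ p = ((s.1 a).2, (s.2 b).2).
Proof.
elim: t P => [|s t IH] P /=; first by left.
case/IH => [|[s' s't es']]; last by right; exists s'; rewrite // inE s't orbT.
rewrite /update; case: (boolP (e _ _)) => es; last by left.
case/setU1P => [->|]; last by left.
by right; exists s; rewrite // inE eqxx.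
Qed.

(** The adjacency at [c] puts (f(a,c), f(b,c)) into the set of the pair (a,b); those at [a] and [b]
    are together what [allowed] then forbids. *)
Lemma bad_codeP (u : {ffun pos -> W}) :
  (forall a b c, ~~ [&& e (u (inr ((a, b), false))) (u (inl (c, (a, (false, true))))),
      e (u (inr ((a, b), true))) (u (inl (c, (b, (true, true))))) &
      e (u (inl (c, (a, (false, false))))) (u (inl (c, (b, (true, false)))))]) ->
  bad_code u.
Proof.
move=> nog; rewrite /bad_code; set t := (decode u).1; apply/forallP => -[a b].
rewrite inE; apply/forall_inP => p; rewrite [(a, b).1]/= [(a, b).2]/=.
case/mem_foldl_update => [|[s /tnthP[c ->]]]; first by rewrite inE.
rewrite /t decode_step [(_, _).1]/= [(_, _).2]/= !ffunE => -[ec ->].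
by have := nog a b c; rewrite [X in _ && (_ && X)]ec andbT.
Qed.

Definition good_triple (M : nat) (f : {ffun 'I_M * 'I_M -> W}) (u v w : 'I_M) :=
  [&& e (f (u, v)) (f (u, w)), e (f (v, u)) (f (v, w)) & e (f (w, u)) (f (w, v))].

(** Union bound over the at most [M ^ (3 * m)] injections of A + B + C. Each sees [6 * m ^ 2]
    distinct labels, and [bad_count_empty] bounds the bad codes. *)
Lemma labelling_exists (M : nat) :
  M ^ (3 * m) * 2 ^ m < 2 ^ (128 * mu ^ 2 * (j - 33)) ->
  exists f : {ffun 'I_M * 'I_M -> W}, forall phi : U -> 'I_M, injective phi ->
    exists a b c, good_triple f (phi (inl (inl a))) (phi (inl (inr b))) (phi (inr c)).
Proof.
move=> ltM.
pose bad (phi : {ffun U -> 'I_M}) := [set f : {ffun 'I_M * 'I_M -> W} |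
  bad_code [ffun p => f (phi (place p).1, phi (place p).2)]].
have card_pos : #|{: pos}| = 6 * m ^ 2.
  by rewrite !card_sum !card_prod !card_bool card_ord -mulnn; lia.
have card_badphi (phi : {ffun U -> 'I_M}) : injective phi ->
    #|bad phi| * r ^ (6 * m ^ 2) <= r ^ (M * M) * bad_count m (fun _ _ => set0).
  move=> phi_inj; have := @card_restrict ('I_M * 'I_M)%type pos W
    (fun p => (phi (place p).1, phi (place p).2)) bad_code.
  rewrite card_prod card_ord card_pos => le.
  apply: leq_trans (le _) _; last by rewrite leq_mul2l card_bad_code orbT.
  move=> p q [/phi_inj e1 /phi_inj e2]; apply: place_inj.
  by rewrite (surjective_pairing (place p)) e1 e2 -surjective_pairing.
pose all_bad := \bigcup_(phi : {ffun U -> 'I_M} | injectiveb phi) bad phi.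
have [f nf] : exists f, f \notin all_bad.
  apply/existsP; apply: contraTT ltM => /existsPn all_in; rewrite -leqNgt.
  have le1 : r ^ (M * M) <= \sum_(phi : {ffun U -> 'I_M} | injectiveb phi) #|bad phi|.
    have <- : #|all_bad| = r ^ (M * M).
      rewrite -[in RHS](card_ord M) -card_prod -card_ffun; apply: eq_card => f.
      by rewrite inE; have := all_in f; rewrite negbK.
    rewrite /all_bad; elim/big_rec2: _ => [|phi u B _ le]; first by rewrite cards0.
    by apply: leq_trans (cardsU_le _ _) _; rewrite leq_add2l.
  have rM0 : 0 < r ^ (M * M) by rewrite expn_gt0 W0.
  have r60 : 0 < r ^ (6 * m ^ 2) by rewrite expn_gt0 W0.
  have le2 : r ^ (6 * m ^ 2) <= M ^ (3 * m) * bad_count m (fun _ _ => set0).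
    rewrite -(leq_pmul2l rM0).
    apply: leq_trans (leq_mul le1 (leqnn _)) _; rewrite big_distrl /=.
    apply: (@leq_trans (\sum_(phi : {ffun U -> 'I_M})
        r ^ (M * M) * bad_count m (fun _ _ => set0))).
      rewrite big_mkcond /=; apply: leq_sum => phi _.
      by case: ifP => // /injectiveP; apply: card_badphi.
    rewrite sum_nat_const card_ffun !card_sum !card_ord.
    have e3 : m + m + m = 3 * m by lia.
    by rewrite e3 mulnCA leqnn.
  rewrite -(leq_pmul2r r60) mulnC.
  apply: leq_trans (leq_mul le2 (leqnn _)) _.
  by rewrite -!(mulnA (M ^ _)) leq_mul2l bad_count_empty orbT.
exists f => phi phi_inj; apply: contrapT => nog.
move/negP: nf; apply; apply/bigcupP; exists (finfun phi).
  by apply/injectiveP => x y; rewrite !ffunE; apply: phi_inj.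
rewrite inE; set u := (X in bad_code X).
have -> : u = [ffun p => f (phi (place p).1, phi (place p).2)].
  by apply/ffunP => p; rewrite !ffunE.
apply: bad_codeP => a b c; rewrite !ffunE; apply/negP => gd.
by apply: nog; exists a, b, c.
Qed.

End StepCount.

(** * Lower bound *)

Lemma far_rel_sym d t : symmetric (@far_rel d t).
Proof. by move=> x y; rewrite /far_rel hamming_sym. Qed.

Section LabelGraph.
Variables (W : finType) (e : rel W) (M : nat) (f : {ffun 'I_M * 'I_M -> W}).

Definition label_edges : {set {set 'I_M}} :=
  [set E : {set 'I_M} | (#|E| == 3) && [forall u in E, forall v in E, forall w in E,
     [&& u != v, u != w & v != w] ==> e (f (u, v)) (f (u, w))]].

Fact label_card E : E \in label_edges -> #|E| = 3.
Proof. by rewrite inE => /andP[/eqP]. Qed.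

Definition label_graph : graph3 'I_M := Graph3 label_card.

Lemma label_graphP E u v w : E \in edges3 label_graph ->
  u \in E -> v \in E -> w \in E -> u != v -> u != w -> v != w ->
  e (f (u, v)) (f (u, w)).
Proof.
rewrite inE => /andP[_ /forall_inP lab] uE vE wE uv uw vw.
move/forall_inP: (lab u uE) => /(_ v vE) /forall_inP /(_ w wE).
by rewrite uv uw vw.
Qed.

Lemma label_graph_link (V : finType) (G : sgraph V) :
  contains_copy (link G) label_graph ->
  exists psi : V -> W, forall x y, G x y -> e (psi x) (psi y).
Proof.
case=> g g_inj g_edge; exists (fun x => f (g None, g (Some x))) => x y Gxy.
have nxy : x != y by apply: contraTneq Gxy => ->; rewrite adj_irr.
apply: (@label_graphP (g @: [set None; Some x; Some y])).
- by apply: g_edge; apply/imsetP; exists (x, y); rewrite // inE.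
- by apply: imset_f; rewrite !inE.
- by apply: imset_f; rewrite !inE eqxx.
- by apply: imset_f; rewrite !inE eqxx orbT.
- by rewrite (inj_eq g_inj).
- by rewrite (inj_eq g_inj).
- by rewrite (inj_eq g_inj) (inj_eq (@Some_inj _)).
Qed.

Lemma good_triple_edge u v w : symmetric e ->
  u != v -> u != w -> v != w -> good_triple e f u v w ->
  [set u; v; w] \in edges3 label_graph.
Proof.
move=> e_sym uv uw vw /and3P[g1 g2 g3]; rewrite inE; apply/andP; split.
  by rewrite -setUA cardsU1 cards2 !inE negb_or uv uw vw.
apply/forall_inP => a aE; apply/forall_inP => b bE; apply/forall_inP => c cE.
apply/implyP => /and3P[]; move: aE bE cE; rewrite !inE -!orbA.
by case/or3P => /eqP->; case/or3P => /eqP->; case/or3P => /eqP->;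
  rewrite ?eqxx // => _ _ _; rewrite // e_sym.
Qed.

End LabelGraph.

(** A copy of the link would give a homomorphism from [G] to [e]. In a copy of the complete
    hypergraph, the first [192 * mu] vertices serve as A, B and C and span a good triple, which is
    an edge. *)
Lemma link_ramsey_avoid (V : finType) (G : sgraph V) (W : finType) (e : rel W)
    (h j mu n M : nat) :
  symmetric e ->
  (forall S T : {set W},
    (forall x y, x \in S -> y \in T -> ~~ e x y) -> #|S| <= h \/ #|T| <= h) ->
  h * 2 ^ j = #|W| -> 0 < #|W| -> 4 * #|W| ^ 3 <= mu -> 33 <= j ->
  (forall psi : V -> W, ~ forall x y, G x y -> e (psi x) (psi y)) ->
  192 * mu <= n ->
  M ^ (3 * (64 * mu)) * 2 ^ (64 * mu) < 2 ^ (128 * mu ^ 2 * (j - 33)) ->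
  ~ ramsey_prop (link G) (complete3 n) M.
Proof.
move=> e_sym expand hW W0 muW j33 nohom mun ltM ram.
have [f good] := labelling_exists expand hW W0 muW j33 ltM.
case: (ram _ (label_graph e f) (card_ord M)) => [/label_graph_link[psi]|[g g_inj gE]].
  exact: nohom.
have lt1 (a : 'I_(64 * mu)) : a < n by have := ltn_ord a; lia.
have lt2 (a : 'I_(64 * mu)) : 64 * mu + a < n by have := ltn_ord a; lia.
have lt3 (a : 'I_(64 * mu)) : 128 * mu + a < n by have := ltn_ord a; lia.
pose emb (u : 'I_(64 * mu) + 'I_(64 * mu) + 'I_(64 * mu)) : 'I_n :=
  match u with
  | inl (inl a) => Ordinal (lt1 a)
  | inl (inr b) => Ordinal (lt2 b)
  | inr c => Ordinal (lt3 c)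
  end.
have emb_inj : injective emb.
  move=> [[a|a]|a] [[b|b]|b] /(congr1 val) /= eq_ab; have := ltn_ord a;
    have := ltn_ord b => ltb lta; try (exfalso; lia);
    do ?congr inl; congr inr || congr inl || idtac; apply: val_inj => /=; lia.
have [a [b [c gd]]] := good (g \o emb) (inj_comp g_inj emb_inj).
set x := inl (inl a) in gd; set y := inl (inr b) in gd; set z := inr c in gd.
have gneq u v : u != v -> (g \o emb) u != (g \o emb) v.
  by rewrite (inj_eq (inj_comp g_inj emb_inj)).
have inE3 : [set (g \o emb) x; (g \o emb) y; (g \o emb) z] \in edges3 (label_graph e f).
  by apply: good_triple_edge gd; rewrite // gneq.
have in3 : [set emb x; emb y; emb z] \in edges3 (complete3 n).
  by rewrite inE -setUA cardsU1 cards2 !inE !(inj_eq emb_inj).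
have := gE _ in3; rewrite !imsetU !imset_set1 in_set => /andP[_ /negP[]].
exact: inE3.
Qed.

Lemma link_ramsey_lower (V : finType) (G : sgraph V) : ~ bipartite G ->
  exists K n0 : nat, 0 < K /\ forall n N : nat, n0 <= n ->
    ramsey_prop (link G) (complete3 n) N -> n ^ n <= N ^ K.
Proof.
move=> nbip.
(* [far_rel_bipartite] needs [l] above [2 * #|V| + 2]; [b ^ j] is the third power of the number of
   points of the cube used; [E] ensures [n <= 2 ^ (E * j)]. *)
pose l := 2 * #|V| + 3; pose E := 24 * l ^ 2 + 11; pose b := 2 ^ (12 * l ^ 2).
have l0 : 0 < l by rewrite /l addn3.
have l20 : 0 < l ^ 2 by rewrite expn_gt0 l0.
have b1 : 1 < b by rewrite /b -{1}(expn0 2) ltn_exp2l // muln_gt0.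
exists (1152 * E), (192 * (4 * b ^ 132)); split; first by rewrite muln_gt0 /E addn_gt0 orbT.
move=> n N n0n ram; rewrite leqNgt; apply/negP => ltN.
pose mu := n %/ 192.
have mu_big : 4 * b ^ 132 <= mu by rewrite /mu leq_divRL // mulnC.
pose q := mu %/ 4.
have q_big : b ^ 132 <= q by rewrite /q leq_divRL // mulnC.
have q0 : 0 < q by apply: leq_trans q_big; rewrite expn_gt0 ltnW.
(* The largest [j] with [4 * b ^ j <= mu], so that log n is of order [j]. *)
pose j := trunc_log b q.
have /andP[bj bj1] := trunc_log_bounds b1 q0; rewrite -/j in bj bj1.
have j132 : 132 <= j.
  rewrite -ltnS -(ltn_exp2l _ _ b1); exact: leq_ltn_trans bj1.
clear n0n mu_big q_big.
pose d := 4 * l ^ 2 * j.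
have r3 : #|cube d| ^ 3 = b ^ j.
  by rewrite card_cube /b /d -!expnM; congr (_ ^ _); lia.
have jd : j <= d by rewrite leq_pmull // muln_gt0.
have mu4 : 4 * b ^ j <= mu.
  by apply: leq_trans (leq_mul (leqnn 4) bj) _; rewrite mulnC leq_trunc_div.
have mu0 : 0 < mu by apply: leq_trans mu4; rewrite muln_gt0 expn_gt0 (ltnW b1).
have n_mu : n <= 384 * mu.
  by have := divn_eq n 192; have := ltn_pmod n (isT : 0 < 192); rewrite -/mu; lia.
have n_E : n <= 2 ^ (E * j).
  have lt_mu : mu < b ^ j.+1 * 4 by rewrite -ltn_divLR.
  apply: (@leq_trans (1536 * b ^ j.+1)).
    by apply: leq_trans n_mu _; move: lt_mu; move: (b ^ _) => u; lia.
  apply: (@leq_trans (2 ^ 11 * b ^ j.+1)); first by rewrite leq_mul2r orbC.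
  rewrite /b -expnM -expnD leq_exp2l // /E.
  have : l ^ 2 <= l ^ 2 * j by rewrite leq_pmulr //; lia.
  by rewrite mulnS mulnDl -!mulnA; move: (l ^ 2) (l ^ 2 * j); lia.
have E0 : 0 < E by rewrite /E addn_gt0 orbT.
(* The exponent 1152 is 3 * 384: a root of order [384 * E] is taken of both sides of [ltN]. *)
have N3 : N ^ 3 < 2 ^ (j * mu).
  have E384 : 0 < 384 * E by rewrite muln_gt0 E0.
  rewrite -(ltn_exp2r _ _ E384) -!expnM mulnA.
  apply: leq_trans ltN _; apply: (@leq_trans ((2 ^ (E * j)) ^ n)).
    by rewrite leq_exp2r //; lia.
  rewrite -expnM leq_exp2l //.
  apply: leq_trans (leq_mul (leqnn _) n_mu) _.
  by rewrite (_ : E * j * (384 * mu) = j * mu * (384 * E)) //; lia.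
apply: (@link_ramsey_avoid V G (cube d) (far_rel (4 * l * j)) (2 ^ (d - j)) j mu n N) ram.
- exact: far_rel_sym.
- by move=> S T; apply: far_rel_expand.
- by rewrite card_cube -expnD subnK.
- by rewrite card_cube expn_gt0.
- by rewrite r3.
- exact: leq_trans j132.
- move=> psi homo; apply: nbip; apply: far_rel_bipartite homo.
  have -> : 2 * (#|V|.+1 * (4 * l * j)) = 4 * (l * j) * (2 * #|V| + 2) by lia.
  have -> : d = 4 * (l * j) * l by rewrite /d -mulnn; lia.
  by rewrite ltn_pmul2l ?ltn_add2l // !muln_gt0 l0; lia.
- by rewrite mulnC leq_trunc_div.
(* As [j] is at least 132, an exponent of about [64 * j * mu ^ 2] stays below
   [128 * (j - 33) * mu ^ 2]. *)
- apply: (@leq_ltn_trans (2 ^ (j * mu * (64 * mu)) * 2 ^ (64 * mu))).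
    rewrite leq_mul2r; apply/orP; right; rewrite !expnM.
    by rewrite -!(expnM _ 64) leq_exp2r ?muln_gt0 // ltnW // -expnM.
  rewrite -expnD ltn_exp2l // -mulnn -(subnK (_ : 33 <= j)); last by lia.
  rewrite addnK; have : 99 <= j - 33 by lia.
  have : mu <= mu * mu by rewrite leq_pmulr.
  move: (j - 33) => k le1 le2; have : mu * mu * 99 <= mu * mu * k by rewrite leq_mul2l le2 orbT.
  by nia.
Qed.

Local Open Scope ring_scope.

Theorem theorem1p2 (R : realType) (V : finType) (G : sgraph V) :
  ~ bipartite G ->
  exists c C : R, 0 < c /\ 0 < C /\
    exists n0 : nat, forall n : nat, (n0 <= n)%N ->
      exists N : nat, is_ramsey_number (link G) (complete3 n) N /\
        n%:R `^ (c * n%:R) <= N%:R /\ N%:R <= n%:R `^ (C * n%:R).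
Proof.
move=> /link_ramsey_lower[K [n0 [K0 lower]]].
have KR : (0 : R) < K%:R by rewrite Num.Theory.ltr0n.
(* The lower constant inverts [n ^ n <= N ^ K]; the 3 comes from [2 * n + 2 <= n ^ 3], valid from n
   = 2 on. *)
exists K%:R^-1, (3 * #|V|.+1)%:R; split; first by rewrite Num.Theory.invr_gt0.
split; first by rewrite Num.Theory.ltr0n.
exists (maxn n0 2) => n; rewrite geq_max => /andP[n0n n2].
have up := @link_ramsey_upper V G n.
have exN : exists N, `[< ramsey_prop (link G) (complete3 n) N >].
  by exists ((2 * n + 2) ^ (n * #|V|.+1))%N; apply/asboolP.
case: (ex_minnP exN) => N /asboolP ramN minN; exists N; split.
  by split=> // M ramM; apply: minN; apply/asboolP.
split.
  have := lower n N n0n ramN; rewrite -(Num.Theory.ler_nat R) !GRing.natrX => le_nN.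
  rewrite GRing.mulrC powRrM powR_mulrn ?Num.Theory.ler0n //.
  apply: (@Order.POrderTheory.le_trans _ _ ((N%:R ^+ K) `^ K%:R^-1)).
    by apply: ge0_ler_powR; rewrite ?Num.Theory.nnegrE ?Num.Theory.invr_ge0 ?Num.Theory.exprn_ge0.
  rewrite -powR_mulrn ?Num.Theory.ler0n // -powRrM GRing.divff ?Order.POrderTheory.gt_eqF //.
  by rewrite powRr1 ?Num.Theory.ler0n.
rewrite -GRing.natrM powR_mulrn ?Num.Theory.ler0n // -GRing.natrX Num.Theory.ler_nat.
apply: leq_trans (minN _ _) _; first exact/asboolP/up.
rewrite -mulnA [(#|V|.+1 * n)%N]mulnC (expnM n 3).
case: n {n0n up exN minN ramN lower} n2 => // n n2.
rewrite leq_exp2r ?muln_gt0 // !expnS expn0; nia.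
Qed.
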